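(* The Poisson manifolds $(W_3,e_1)$ and $(W_3,e_2)$, where $W_3=\mathrm{Tot}(\mathcal O_{\mathbb P^1}(-3)\oplus\mathcal O_{\mathbb P^1}(1))$ and $e_1,e_2$ are the Poisson structures specified in the context, are not isomorphic.
   Context: $W_3$ is obtained by gluing $U=\mathbb C^3_{\{z,u_1,u_2\}}$ and $V=\mathbb C^3_{\{\xi,v_1,v_2\}}$ by $(\xi,v_1,v_2)=(z^{-1},z^3u_1,z^{-1}u_2)$ where $z,\xi\neq0$. Write $\partial_1=\partial/\partial u_1$, $\partial_2=\partial/\partial u_2$. The global holomorphic Poisson structures $e_1,e_2$ on $W_3$ are given on $U$ by $e_1=u_1\,\partial_1\wedge\partial_2$ and $e_2=u_1u_2\,\partial_1\wedge\partial_2$. Poisson manifolds $(W_3,\pi)$ and $(W_3,\pi')$ are isomorphic if there is a biholomorphism $\phi:W_3\to W_3$ with $\phi_*\pi=\pi'$. *)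

(* Defs.v *)
From HB Require Import structures.
From mathcomp Require Import all_boot all_order all_algebra.
From mathcomp Require Import generic_quotient complex.
From mathcomp Require Import all_classical all_reals topology normedtype derive.

Set Implicit Arguments.
Unset Strict Implicit.
Unset Printing Implicit Defensive.

Import Order.TTheory GRing.Theory Num.Theory.
Import numFieldNormedType.Exports.

Local Open Scope classical_set_scope.
Local Open Scope ring_scope.
Local Open Scope quotient_scope.
Local Open Scope complex_scope.

(* R[i] carries no topology of its own; as a numFieldType it gets the one of
   the modulus, and 'rV[CC R]_3 the sup norm.  Over this field [differentiable]
   means complex differentiable, i.e. holomorphic when it holds at every point
   of an open set. *)
Definition CC (R : realType) : numClosedFieldType := R[i].
Notation C3 R := 'rV[CC R]_3.

(* There are two charts, indexed by bool: [chU] with coordinates (z, u1, u2)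
   and [chV] with coordinates (xi, v1, v2), both numbered 0, 1, 2. *)
Notation chU := false.
Notation chV := true.

Section W3.
Variable R : realType.
Local Notation C := (CC R).
Local Notation C3 := (C3 R).
Implicit Types (c d : bool) (x y : C3).

Definition vec3 (a0 a1 a2 : C) : C3 := \row_i nth 0 [:: a0; a1; a2] i.

Definition q0 x : C := x 0 (inord 0).
Definition q1 x : C := x 0 (inord 1).
Definition q2 x : C := x 0 (inord 2).

(* (xi, v1, v2) = (z^-1, z^3 u1, z^-1 u2); solving for (z, u1, u2) gives
   (xi^-1, xi^3 v1, xi^-1 v2), so that the same formula serves as the
   transition map in both directions. *)
Definition trans x : C3 :=
  vec3 (q0 x)^-1 (q0 x ^+ 3 * q1 x) ((q0 x)^-1 * q2 x).

Lemma q0E a0 a1 a2 : q0 (vec3 a0 a1 a2) = a0.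
Proof. by rewrite /q0 mxE inordK. Qed.

Lemma q1E a0 a1 a2 : q1 (vec3 a0 a1 a2) = a1.
Proof. by rewrite /q1 mxE inordK. Qed.

Lemma q2E a0 a1 a2 : q2 (vec3 a0 a1 a2) = a2.
Proof. by rewrite /q2 mxE inordK. Qed.

Lemma vec3P x : x = vec3 (q0 x) (q1 x) (q2 x).
Proof.
apply/rowP => -[[|[|[|//]]] lt3] /=; rewrite mxE /= /q0 /q1 /q2;
  by congr (x 0 _); apply/val_inj; rewrite /= inordK.
Qed.

Lemma transK x : q0 x != 0 -> trans (trans x) = x.
Proof.
move=> x0; rewrite [RHS]vec3P {1}/trans !(q0E, q1E, q2E) invrK.
by rewrite mulrA -exprMn mulVf// expr1n mul1r mulVKf.
Qed.

Lemma q0_trans x : q0 x != 0 -> q0 (trans x) != 0.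
Proof. by rewrite q0E invr_eq0. Qed.

(* W3, the total space of O(-3) (+) O(1) over P^1, is the quotient of the
   disjoint union of the two charts by x ~ trans x for q0 x != 0, with the
   quotient topology. *)
Definition glue_rel (p q : {_ : bool & C3}) :=
  (p == q) || [&& projT1 p != projT1 q, q0 (projT2 p) != 0
                & projT2 q == trans (projT2 p)].

Lemma glue_refl : reflexive glue_rel.
Proof. by move=> p; rewrite /glue_rel eqxx. Qed.

Lemma glue_symW p q : glue_rel p q -> glue_rel q p.
Proof.
case/orP => [/eqP->|/and3P[npq p0 /eqP qE]]; first exact: glue_refl.
by apply/orP; right; rewrite eq_sym npq qE q0_trans// transK// eqxx.
Qed.

Lemma glue_sym : symmetric glue_rel.
Proof. by move=> p q; apply/idP/idP; exact: glue_symW. Qed.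

Lemma glue_trans : transitive glue_rel.
Proof.
move=> q p r /orP[/eqP->//|pq]; case/orP => [/eqP<-|].
  by rewrite /glue_rel pq orbT.
case: p q r pq => [c x] [d y] [e z] /= /and3P[cd x0 /eqP ->].
case/and3P => de _ /eqP; rewrite transK// => ->.
by rewrite /glue_rel; case: c d e cd de => [] [] [] // _ _; rewrite eqxx.
Qed.

Definition glue_equiv := EquivRel glue_rel glue_refl glue_sym glue_trans.

Definition W3 := {eq_quot glue_equiv}.

HB.instance Definition _ := Topological.copy W3 (quotient_topology W3).
HB.instance Definition _ := Quotient.on W3.

Definition incl c x : W3 := \pi_W3 (existT (fun=> C3) c x).

(* The coordinates of a point in the chart c.  They are meaningful on the
   domain [range (incl c)] only; elsewhere the value is arbitrary. *)
Definition chart c (w : W3) : C3 :=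
  let p := repr w in if projT1 p == c then projT2 p else trans (projT2 p).

Lemma incl_eqP c d x y : incl c x = incl d y <->
  (c = d /\ x = y) \/ [/\ c <> d, q0 x != 0 & y = trans x].
Proof.
rewrite /incl; split.
  move/eqmodP/orP => [/eqP|/and3P[/= /eqP cd x0 /eqP ->]]; last by right.
  case=> -> /= ?; left; split => //.
case=> [[-> ->]//|[cd x0 ->]]; apply/eqmodP/orP; right => /=.
by rewrite x0 eqxx/= andbT; apply/eqP.
Qed.

Lemma chartK c : cancel (incl c) (chart c).
Proof.
move=> x; rewrite /chart; have := reprK (incl c x).
case: (repr _) => d y /= /incl_eqP[[-> ->]|[dc y0 ->]]; first by rewrite eqxx.
by case: eqP.
Qed.

Lemma chart_incl c w : range (incl c) w -> incl c (chart c w) = w.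
Proof. by case=> x _ <-; rewrite chartK. Qed.

Lemma incl_cover w : exists c x, w = incl c x.
Proof.
by have := reprK w; case: (repr w) => c x /= <-; exists c, x.
Qed.

Definition local_rep (f : W3 -> W3) c d : C3 -> C3 :=
  chart d \o f \o incl c.

Definition holomorphic (f : W3 -> W3) :=
  continuous f /\
  forall c d x, range (incl d) (f (incl c x)) ->
    differentiable (local_rep f c d) x.

Definition biholomorphic (f : W3 -> W3) :=
  holomorphic f /\
  exists g : W3 -> W3, [/\ holomorphic g, cancel f g & cancel g f].

(* A bivector sum_(i < j) P i j d_i /\ d_j at a point of C^3 is encoded by the
   alternating matrix P.  Tangent vectors are row vectors, on which a Jacobian
   acts on the right: d f x v = v *m 'J f x. *)
Definition wedge (a b : C3) : 'M[C]_3 := a^T *m b - b^T *m a.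

Lemma wedge_scale (h k : C) a b :
  wedge (h *: a) (k *: b) = (h * k) *: wedge a b.
Proof.
apply/matrixP => i j; rewrite /wedge !mxE !big_ord1 !mxE mulrBr.
by congr (_ - _); rewrite mulrACA // (mulrC h k).
Qed.

Definition del (l : 'I_3) : C3 := delta_mx 0 l.

Definition push (f : C3 -> C3) x (P : 'M[C]_3) : 'M[C]_3 :=
  ('J f x)^T *m P *m 'J f x.

Lemma push_wedge f x a b :
  push f x (wedge a b) = wedge (a *m 'J f x) (b *m 'J f x).
Proof. by rewrite /push /wedge mulmxBr mulmxBl !trmx_mul !mulmxA. Qed.

(* The component (i, j, k) of the Schouten bracket [P, P], up to a nonzero
   constant. *)
Definition schouten (P : C3 -> 'M[C]_3) x (i j k : 'I_3) : C :=
  let D l m n := 'D_(del l) (fun y => P y m n) x in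
  \sum_l (P x i l * D l j k + P x j l * D l k i + P x k l * D l i j).

Record poisson := Poisson {
  coef :> bool -> C3 -> 'M[C]_3 ;
  coef_alt : forall c x, (coef c x)^T = - coef c x ;
  coef_holo : forall c x, differentiable (coef c) x ;
  coef_glue : forall c x, q0 x != 0 ->
    coef (~~ c) (trans x) = push trans x (coef c x) ;
  coef_jacobi : forall c x i j k, schouten (coef c) x i j k = 0 }.

(* f_* pi = pi', read in all pairs of charts. *)
Definition pushes_to (f : W3 -> W3) (pi pi' : poisson) :=
  forall c d x y, f (incl c x) = incl d y ->
    push (local_rep f c d) x (pi c x) = pi' d y.

Definition poisson_isomorphic (pi pi' : poisson) :=
  exists f : W3 -> W3, biholomorphic f /\ pushes_to f pi pi'.

Definition d12 : 'M[C]_3 := wedge (del (inord 1)) (del (inord 2)).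

Lemma differentiable_q0 x : differentiable q0 x.
Proof. exact: differentiable_coord. Qed.

Lemma differentiable_q1 x : differentiable q1 x.
Proof. exact: differentiable_coord. Qed.

Lemma differentiable_q2 x : differentiable q2 x.
Proof. exact: differentiable_coord. Qed.

Lemma vec3_del a0 a1 a2 : vec3 a0 a1 a2 =
  a0 *: del (inord 0) + a1 *: del (inord 1) + a2 *: del (inord 2).
Proof.
apply/rowP => -[[|[|[|//]]] lt3];
  by rewrite !mxE /= -!val_eqE /= !inordK //= ?(mulr1, mulr0, addr0, add0r).
Qed.

Lemma differentiable_trans x : q0 x != 0 -> differentiable trans x.
Proof.
move=> x0; rewrite (_ : trans = (fun y => (q0 y)^-1 *: del (inord 0)) \+
  (fun y => (q0 y ^+ 3 * q1 y) *: del (inord 1)) \+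
  (fun y => ((q0 y)^-1 * q2 y) *: del (inord 2))); last first.
  by apply/funext => y; rewrite /trans vec3_del.
have dV : differentiable (fun y => (q0 y)^-1) x.
  by apply: differentiableV => //; exact: differentiable_q0.
apply: differentiableD; first apply: differentiableD.
- exact: differentiableZl.
- apply: differentiableZl; apply: differentiableM; last exact: differentiable_q1.
  do 2?[apply: (@differentiableM _ _ q0)]; exact: differentiable_q0.
- by apply: differentiableZl; apply: differentiableM => //; exact: differentiable_q2.
Qed.

Lemma derive_affine (f : C3 -> C3) x v w :
  (forall h : C, f (h *: v + x) = h *: w + f x) -> 'D_v f x = w.
Proof.
move=> fE; rewrite /derive; apply: lim_near_cst => //.
near=> h; rewrite /= fE addrK scalerA mulVf ?scale1r//.
by near: h; exact: nbhs_dnbhs_neq.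
Unshelve. all: by end_near. Qed.

Lemma q_del1 (h : C) x : let y := h *: del (inord 1) + x in
  [/\ q0 y = q0 x, q1 y = h + q1 x & q2 y = q2 x].
Proof.
by rewrite /q0 /q1 /q2 !mxE -!val_eqE /= !inordK //= mulr1 mulr0 !add0r.
Qed.

Lemma q_del2 (h : C) x : let y := h *: del (inord 2) + x in
  [/\ q0 y = q0 x, q1 y = q1 x & q2 y = h + q2 x].
Proof.
by rewrite /q0 /q1 /q2 !mxE -!val_eqE /= !inordK //= mulr1 mulr0 !add0r.
Qed.

Lemma push_d12 x : q0 x != 0 -> push trans x d12 = q0 x ^+ 2 *: d12.
Proof.
move=> x0; have dt := differentiable_trans x0.
rewrite push_wedge -!deriveEjacobian//.
rewrite (@derive_affine _ _ _ (q0 x ^+ 3 *: del (inord 1))); last first.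
  move=> h; have [e0 e1 e2] := q_del1 h x; rewrite /trans e0 e1 e2 !vec3_del.
  rewrite mulrDr scalerDl scalerA (mulrC h).
  by rewrite addrCA -!addrA.
rewrite (@derive_affine _ _ _ ((q0 x)^-1 *: del (inord 2))); last first.
  move=> h; have [e0 e1 e2] := q_del2 h x; rewrite /trans e0 e1 e2 !vec3_del.
  by rewrite mulrDr scalerDl scalerA (mulrC h) addrCA.
by rewrite wedge_scale exprSr mulfK.
Qed.

Lemma d12_alt : d12^T = - d12.
Proof. by rewrite /d12 /wedge linearB /= !trmx_mul !trmxK opprB. Qed.

Lemma d12_plucker i j k l :
  d12 i l * d12 j k + d12 j l * d12 k i + d12 k l * d12 i j = 0.
Proof.
have dE m n : d12 m n = ((m == 1%N :> nat) && (n == 2%N :> nat))%:R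
                      - ((m == 2%N :> nat) && (n == 1%N :> nat))%:R.
  rewrite /d12 /wedge /del !trmx_delta !mul_delta_mx !mxE -!val_eqE /=.
  by rewrite !inordK.
rewrite !dE.
case: i j k l => [[|[|[|//]]] ?] [[|[|[|//]]] ?] [[|[|[|//]]] ?] [[|[|[|//]]] ?] /=;
  by rewrite ?(subr0, sub0r, subrr, mulr0, mul0r, mulrN, mulNr, mulr1, addr0, add0r, addrN, addNr, oppr0).
Qed.

Lemma schouten_d12 (g : C3 -> C) x i j k : differentiable g x ->
  schouten (fun y => g y *: d12) x i j k = 0.
Proof.
move=> dg; rewrite /schouten big1// => l _.
have D m n : 'D_(del l) (fun y => (g y *: d12) m n) x
    = d12 m n * 'D_(del l) g x.
  have -> : (fun y => (g y *: d12) m n) = d12 m n \*: g.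
    by apply/funext => y; rewrite mxE mulrC.
  by rewrite deriveZ//; exact: diff_derivable.
have S m n : (g x *: d12) m n = g x * d12 m n by rewrite mxE.
rewrite !D !S !(mulrC (g x)) !(mulrACA _ (g x)) -!mulrDl.
by rewrite d12_plucker mul0r.
Qed.

Section d12_poisson.
Variable g : bool -> C3 -> C.
Hypothesis g_holo : forall c x, differentiable (g c) x.
Hypothesis g_glue : forall c x, q0 x != 0 ->
  g (~~ c) (trans x) = q0 x ^+ 2 * g c x.

Let P c y := g c y *: d12.

Lemma d12_coef_alt c x : (P c x)^T = - P c x.
Proof. by rewrite /P -scalerN -d12_alt; apply/matrixP => i j; rewrite !mxE. Qed.

Lemma d12_coef_holo c x : differentiable (P c) x.
Proof. exact: differentiableZl. Qed.

Lemma d12_coef_glue c x : q0 x != 0 ->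
  P (~~ c) (trans x) = push trans x (P c x).
Proof.
move=> x0; rewrite /push -scalemxAr -scalemxAl -/(push _ _ _) push_d12//.
by rewrite scalerA /P g_glue// mulrC.
Qed.

Lemma d12_coef_jacobi c x i j k : schouten (P c) x i j k = 0.
Proof. exact: schouten_d12. Qed.

Definition d12_poisson : poisson :=
  Poisson d12_coef_alt d12_coef_holo d12_coef_glue d12_coef_jacobi.

End d12_poisson.

(* On V the coefficients are forced: d/du1 = z^3 d/dv1 and d/du2 = z^-1 d/dv2,
   so d/du1 /\ d/du2 = xi^-2 d/dv1 /\ d/dv2, while u1 = xi^3 v1 and
   u2 = xi^-1 v2. *)
Definition g1 c x : C := if c is chU then q1 x else q0 x * q1 x.
Definition g2 c x : C := q1 x * q2 x.

Lemma g1_holo c x : differentiable (g1 c) x.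
Proof.
case: c; last exact: differentiable_q1.
by apply: differentiableM; [exact: differentiable_q0|exact: differentiable_q1].
Qed.

Lemma g2_holo c x : differentiable (g2 c) x.
Proof.
by apply: differentiableM; [exact: differentiable_q1|exact: differentiable_q2].
Qed.

Lemma g1_glue c x : q0 x != 0 -> g1 (~~ c) (trans x) = q0 x ^+ 2 * g1 c x.
Proof.
move=> x0; case: c; rewrite /g1 /= ?q0E q1E.
  by rewrite mulrA -exprSr.
by rewrite mulrA exprS mulKf.
Qed.

Lemma g2_glue c x : q0 x != 0 -> g2 (~~ c) (trans x) = q0 x ^+ 2 * g2 c x.
Proof.
move=> x0; rewrite /g2 q1E q2E mulrACA; congr (_ * _).
by rewrite exprSr mulfK.
Qed.

Definition e1 : poisson := d12_poisson g1_holo g1_glue.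
Definition e2 : poisson := d12_poisson g2_holo g2_glue.

Lemma e1_U x : e1 chU x = q1 x *: d12.
Proof. by []. Qed.

Lemma e2_U x : e2 chU x = (q1 x * q2 x) *: d12.
Proof. by []. Qed.

End W3.

(* Main.v *)
From mathcomp Require Import all_boot all_order all_algebra.
From mathcomp Require Import generic_quotient complex.
From mathcomp Require Import all_classical all_reals topology normedtype derive.
Require Import Defs.

(** Both structures are multiples of one nowhere vanishing bivector in each
    chart, so the degeneracy locus of [e1] is D1 = (g1 = 0) and that of [e2] is
    D2 = (g2 = 0).  On U, D1 is the plane u1 = 0, but on V it is xi v1 = 0: it
    also contains the fibre over xi = 0, and its two components cross along the
    complex line xi = v1 = 0.  D2 is u1 u2 = 0 on U and v1 v2 = 0 on V; its two
    components cross along the zero section, a copy of P^1.  An isomorphism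
    would carry D1 to D2 and the crossing curve of D1 homeomorphically onto
    that of D2, which is impossible because P^1 is compact and the line is not.

    That crossings go to crossings ([crossing_critical]) needs only the first
    derivative of the map F that represents the isomorphism f in charts.  At a
    crossing point x of D1, the defining function g1 vanishes along all three
    coordinate lines through x.  Since F maps D1 to D2, g2 \o F vanishes along
    the same lines, so its differential at x is zero; and since the differential
    of F is invertible, with inverse that of the representative of f^-1
    ([jacobian_local_repK]), the differential of g2 vanishes at F x.  The
    critical points of g2 are exactly the points of the zero section
    ([g2_critical]).  The argument is symmetric: [g1_critical] is its
    counterpart for the inverse of f.

    The topological contradiction is then a boundedness argument: the coordinate
    v2 of f^-1 is a continuous function on the zero section, hence bounded on
    each of the two closed unit discs that cover it ([bounded_on_unit_disc]),
    whereas it has to take every complex value. *)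

Set Implicit Arguments.
Unset Strict Implicit.
Unset Printing Implicit Defensive.

Import Order.TTheory GRing.Theory Num.Theory.
Import numFieldNormedType.Exports.

Local Open Scope classical_set_scope.
Local Open Scope ring_scope.
Local Open Scope quotient_scope.

(** * Directional derivatives *)

Lemma derive_comp (K : numFieldType) (U V W : normedModType K)
    (f : U -> V) (g : V -> W) x v :
  differentiable f x -> differentiable g (f x) ->
  'D_v (g \o f) x = 'D_('D_v f x) g (f x).
Proof.
move=> df dg; rewrite !deriveE//; last exact: differentiable_comp.
by rewrite diff_comp.
Qed.

Lemma derive_line (K : numFieldType) (V W : normedModType K)
    (f : V -> W) x v w :
  (forall h : K, f (h *: v + x) = h *: w + f x) -> 'D_v f x = w.
Proof.
move=> fE; rewrite /derive; apply: lim_near_cst => //.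
near=> h; rewrite /= fE addrK scalerA mulVf ?scale1r//.
by near: h; exact: nbhs_dnbhs_neq.
Unshelve. all: by end_near. Qed.

Lemma derive_basis0 (K : numFieldType) n (W : normedModType K)
    (f : 'rV[K]_n -> W) x v :
  differentiable f x -> (forall i, 'D_(delta_mx 0 i) f x = 0) -> 'D_v f x = 0.
Proof.
move=> df D; rewrite deriveE// (row_sum_delta v) linear_sum big1// => i _.
by rewrite linearZ /= -deriveE// D scaler0.
Qed.

(** * Boundedness of continuous functions on the complex unit disc *)

Section Disc.
Variable R : realType.
Local Notation C := (CC R).

Lemma norm_real_complex (r : R) : `|(r%:C)%C : C| = (`|r|%:C)%C.
Proof. by rewrite normc_def /= expr0n /= addr0 sqrtr_sqr. Qed.

Lemma continuous_real_complex : continuous (real_complex R : R -> C).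
Proof.
move=> x; apply/cvgrPdist_lt => e e0.
have eE : e = (complex.Re e)%:C%C by rewrite RRe_real// gtr0_real.
have e0' : 0 < complex.Re e by move: e0; rewrite eE ltcR.
near=> t.
rewrite eE -rmorphB norm_real_complex ltcR.
near: t; have /cvgrPdist_lt := @cvg_id _ (nbhs x); apply.
by [].
Unshelve. all: by end_near. Qed.

Lemma continuous_modulus : continuous (fun z : C => complex.Re `|z| : R).
Proof.
have normE (z : C) : `|z| = (complex.Re `|z|)%:C%C.
  by rewrite RRe_real// normr_real.
move=> z; apply/(@cvgrPdist_lt _ _ _ _ (nbhs_filter z)) => e e0.
have near_z : \forall t \near z, `|z - t| < e%:C%C.
  have /(@cvgrPdist_lt _ _ _ _ (nbhs_filter z)) := @cvg_id _ (nbhs z).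
  by apply; rewrite ltcR.
apply: (@filterS _ (nbhs z) (nbhs_filter z) _ _ _ near_z) => t /= zt.
rewrite -ltcR; apply: le_lt_trans zt.
have := ler_dist_dist z t.
by rewrite (normE z) (normE t) -rmorphB norm_real_complex.
Qed.

(** The disc lies in the square of the points x + i y with x and y in [-1, 1],
    which is the continuous image of a compact subset of R * R; so the real
    extreme value theorem applies to the modulus. *)
Lemma bounded_on_unit_disc (h : C -> C) : continuous h ->
  exists M : R, forall z, `|z| <= 1 -> `|h z| <= M%:C%C.
Proof.
move=> hc.
pose sq (p : R * R) : C := real_complex R p.1 + 'i%C * real_complex R p.2.
have sqc : continuous sq.
  move=> p; apply: cvgD; last apply: cvgM.
  - apply: (@continuous_comp _ _ _ fst); first exact: cvg_fst.
    exact: continuous_real_complex.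
  - exact: cvg_cst.
  - apply: (@continuous_comp _ _ _ snd); first exact: cvg_snd.
    exact: continuous_real_complex.
have [|||p _ pmax] := @compact_EVT_max _ R (fun p => complex.Re `|h (sq p)|)
  (`[-1, 1]%classic `*` `[-1, 1]%classic).
- by exists (0, 0); split; rewrite /= in_itv /= lerN10 ler01.
- by apply: compact_setX; exact: segment_compact.
- apply: continuous_subspaceT => p.
  apply: (@continuous_comp _ _ _ (h \o sq)); last exact: continuous_modulus.
  by apply: continuous_comp; [exact: sqc|exact: hc].
exists (complex.Re `|h (sq p)|) => z z1.
rewrite -[X in X <= _]RRe_real ?normr_real// lecR.
have -> : z = sq (complex.Re z, complex.Im z) by rewrite /sq /= -complexE.
apply: pmax; rewrite inE; split; rewrite /= in_itv /= -ler_norml -lecR.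
  exact: le_trans (normc_ge_Re z) z1.
have -> : complex.Im z = - complex.Re ('i%C * z).
  by case: (z) => x y /=; rewrite !(mul0r, mul1r) sub0r opprK.
rewrite normrN; apply: le_trans (normc_ge_Re _) _.
by rewrite normrM normc_def /= expr0n expr1n add0r sqrtr1 mul1r.
Qed.

End Disc.

Section W3.
Variable R : realType.
Local Notation C := (CC R).
Local Notation C3 := (C3 R).
Local Notation W3 := (W3 R).
Implicit Types (c d : bool) (x y : C3) (w : W3) (f g : W3 -> W3).

(** * Charts and local representatives *)

Lemma incl_continuous c : continuous (incl c : C3 -> W3).
Proof.
move=> x; apply: (@continuous_comp _ _ _ (existT (fun=> C3) c) \pi_W3).
  exact: existT_continuous.
exact: pi_continuous.
Qed.

Lemma range_inclE c d x : range (incl d) (incl c x) <-> c = d \/ q0 x != 0.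
Proof.
split=> [[y _ /esym/incl_eqP[[-> _]|[_ x0 _]]]|]; [by left|by right|].
case: (eqVneq c d) => [->|/eqP cd]; first by exists x.
by case=> // x0; exists (trans x) => //; apply/esym/incl_eqP; right.
Qed.

Lemma open_range_incl d : open (range (incl d : C3 -> W3)).
Proof.
suff: open (\pi_W3 @^-1` range (incl d : C3 -> W3)) by [].
apply/sigT_openP => c.
case: (eqVneq c d) => [->|/eqP cd].
  rewrite (_ : _ @^-1` _ = setT); first exact: openT.
  by apply/seteqP; split=> // x _; exists x.
rewrite (_ : _ @^-1` _ = @q0 R @^-1` [set~ 0]).
  apply: open_comp => [x _|].
    exact/differentiable_continuous/differentiable_q0.
  apply/closed_openC/accessible_closed_set1/hausdorff_accessible.
  exact: norm_hausdorff.
apply/seteqP; split=> x /=; first by move/range_inclE => -[//|/eqP].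
by move=> x0; apply/range_inclE; right; apply/eqP.
Qed.

(** This covers also the points outside the chart d, where it determines the
    arbitrary value of [chart]. *)
Lemma chart_incl_other c d x : c <> d -> chart d (incl c x) = trans x.
Proof.
move=> cd; rewrite /chart; have := reprK (incl c x).
case: (repr _) => e y /= /incl_eqP[[-> ->]|[ec y0 ->]].
  by case: eqP.
rewrite transK//; case: eqP => //.
by move: cd ec; case: c d e => [] [] [].
Qed.

Lemma local_repE f c d x y : f (incl c x) = incl d y -> local_rep f c d x = y.
Proof. by move=> fxy; rewrite /local_rep /= fxy chartK. Qed.

Lemma differentiable_local_rep f c d x y : holomorphic f ->
  f (incl c x) = incl d y -> differentiable (local_rep f c d) x.
Proof. by move=> fH fxy; apply: fH.2; rewrite fxy; exists y. Qed.

(** Continuity of f matters here: the charts invert each other only at points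
    that f sends into the open domain of the chart d. *)
Lemma near_local_repK f g c d x y : holomorphic f -> cancel f g ->
  f (incl c x) = incl d y ->
  \forall x' \near x, local_rep g d c (local_rep f c d x') = x'.
Proof.
move=> fH fK fxy; have fi : f \o incl c @ x --> f (incl c x).
  by apply: continuous_comp; [exact: incl_continuous|exact: fH.1].
have : nbhs (f (incl c x)) (range (incl d : C3 -> W3)).
  apply: open_nbhs_nbhs; split; first exact: open_range_incl.
  by rewrite fxy; exists y.
move/fi => near_r.
apply: (@filterS _ (nbhs x) _ _ _ _ near_r) => x' rx'.
by rewrite /local_rep /= chart_incl// fK chartK.
Qed.

Lemma jacobian_local_repK f g c d x y :
  holomorphic f -> holomorphic g -> cancel f g ->
  f (incl c x) = incl d y ->
  'J (local_rep f c d) x *m 'J (local_rep g d c) y = 1%:M.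
Proof.
move=> fH gH fK fxy.
have gyx : g (incl d y) = incl c x by rewrite -fxy fK.
have df := differentiable_local_rep fH fxy.
have dg := differentiable_local_rep gH gyx.
have Fx := local_repE fxy.
rewrite -Fx in dg *.
set F := local_rep f c d in df dg *; set G := local_rep g d c in dg *.
apply/row_matrixP => i; rewrite !rowE mulmxA mulmx1.
have -> : delta_mx 0 i *m 'J F x *m 'J G (F x) = 'D_(delta_mx 0 i) (G \o F) x.
  by rewrite (derive_comp _ df dg) (deriveEjacobian _ df) (deriveEjacobian _ dg).
rewrite -[RHS](@derive_id _ _ x (delta_mx 0 i)).
apply: near_eq_derive.
exact: near_local_repK fxy.
Qed.

Lemma pushes_to_inv f g (pi pi' : poisson R) :
  holomorphic f -> holomorphic g -> cancel f g -> cancel g f ->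
  pushes_to f pi pi' -> pushes_to g pi' pi.
Proof.
move=> fH gH fK gK fpi c d y x gyx.
have fxy : f (incl d x) = incl c y by rewrite -gyx gK.
rewrite -(fpi _ _ _ _ fxy) /push !mulmxA -trmx_mul.
have JJ := jacobian_local_repK fH gH fK fxy.
by rewrite JJ trmx1 mul1mx -mulmxA JJ mulmx1.
Qed.

(** * Degeneracy loci and their crossings *)

Lemma d12_neq0 : d12 R != 0.
Proof.
apply/eqP => /matrixP/(_ (inord 1) (inord 2)).
rewrite /d12 /wedge /del !trmx_delta !mul_delta_mx !mxE -!val_eqE /= !inordK//=.
by rewrite subr0 => /eqP; rewrite oner_eq0.
Qed.

Definition vanishes_on_axes (a : C3 -> C) x :=
  forall i (h : C), a (h *: del R i + x) = 0.

Section Crossing.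
Variables (a b : bool -> C3 -> C) (pi pi' : poisson R) (f g : W3 -> W3).
Hypothesis piE : forall c x, pi c x = a c x *: d12 R.
Hypothesis pi'E : forall c x, pi' c x = b c x *: d12 R.
Hypothesis b_holo : forall c x, differentiable (b c) x.
Hypothesis b_glue : forall c x, q0 x != 0 ->
  b (~~ c) (trans x) = q0 x ^+ 2 * b c x.
Hypothesis b0 : forall c, b c 0 = 0.
Hypothesis fpi : pushes_to f pi pi'.

(** When f sends the point outside the chart d, the arbitrary coordinates that
    the image gets there are those of the origin, where b vanishes too.  So the
    conclusion is available at all the points of a coordinate line. *)
Lemma pushes_zero c d x : a c x = 0 -> b d (local_rep f c d x) = 0.
Proof.
move=> ax; rewrite /local_rep /=.
have [e [y fxy]] := incl_cover (f (incl c x)).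
have /eqP := fpi fxy.
rewrite piE pi'E ax scale0r /push mulmx0 mul0mx eq_sym scaler_eq0.
rewrite (negPf d12_neq0) orbF => /eqP by0.
rewrite fxy; case: (eqVneq e d) => [<-|/eqP ed]; first by rewrite chartK.
rewrite chart_incl_other//.
have -> : d = ~~ e by case: (d) (e) ed => [] [].
have [y0|y0] := eqVneq (q0 y) 0; last by rewrite b_glue// by0 mulr0.
rewrite /trans y0 invr0 expr0n /= !mul0r.
by rewrite vec3_del !scale0r !addr0.
Qed.

(** The composite of b with the representative F of f is zero along the three
    coordinate lines through x, so its differential at x is zero; that of F is
    invertible, so the differential of b vanishes at y. *)
Lemma crossing_critical c d x y (v : C3) :
  holomorphic f -> holomorphic g -> cancel f g -> cancel g f ->
  f (incl c x) = incl d y -> vanishes_on_axes (a c) x ->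
  'D_v (b d) y = 0.
Proof.
move=> fH gH fK gK fxy ax.
have gyx : g (incl d y) = incl c x by rewrite -fxy fK.
have JJ := jacobian_local_repK gH fH gK gyx.
have df := differentiable_local_rep fH fxy.
set F := local_rep f c d in JJ df.
have Fx : F x = y by exact: local_repE fxy.
have ax0 : a c x = 0 by rewrite -(ax 0 0) scale0r add0r.
have dbF i : 'D_(del R i) (b d \o F) x = 0.
  by apply: derive_line => h; rewrite scaler0 add0r /= !pushes_zero.
have dcomp u : 'D_u (b d \o F) x = 'D_(u *m 'J F x) (b d) y.
  by rewrite (derive_comp _ df (b_holo d _)) (deriveEjacobian _ df) Fx.
rewrite -[v]mulmx1 -JJ mulmxA -dcomp; apply: derive_basis0 => //.
by apply: differentiable_comp df _; exact: b_holo.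
Qed.

End Crossing.

Lemma q_del0 (h : C) x : let y := h *: del R (inord 0) + x in
  [/\ q0 y = h + q0 x, q1 y = q1 x & q2 y = q2 x].
Proof.
by rewrite /q0 /q1 /q2 !mxE -!val_eqE /= !inordK //= mulr1 mulr0 !add0r.
Qed.

Lemma del_cases (P : C3 -> Prop) :
  P (del R (inord 0)) -> P (del R (inord 1)) -> P (del R (inord 2)) ->
  forall i, P (del R i).
Proof.
by move=> P0 P1 P2 i; rewrite -(inord_val i); case: i => [[|[|[|]]]].
Qed.

Lemma g1_0 c : g1 c (0 : C3) = 0.
Proof. by case: c; rewrite /g1 /q1 ?mxE ?mulr0. Qed.

Lemma g2_0 c : g2 c (0 : C3) = 0.
Proof. by rewrite /g2 /q1 mxE mul0r. Qed.

(** On U, g1 is a coordinate and has no critical point: this is how the chart is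
    determined. *)
Lemma g1_critical c x : (forall v, 'D_v (g1 c : C3 -> C) x = 0) ->
  [/\ c = chV, q0 x = 0 & q1 x = 0].
Proof.
case: c => D; last first.
  have D1 : 'D_(del R (inord 1)) (g1 chU : C3 -> C) x = (1 : C).
    apply: derive_line => h; have [_ e1 _] := q_del1 h x.
    by rewrite /g1 e1 [_ *: _]mulr1.
  by move/eqP: D1; rewrite D eq_sym oner_eq0.
split=> //.
- rewrite -(D (del R (inord 1))); apply/esym/derive_line => h.
  by have [e0 e1 e2] := q_del1 h x; rewrite /g1 e0 e1 mulrDr mulrC.
- rewrite -(D (del R (inord 0))); apply/esym/derive_line => h.
  by have [e0 e1 e2] := q_del0 h x; rewrite /g1 e0 e1 mulrDl.
Qed.

Lemma g2_critical c x : (forall v, 'D_v (g2 c : C3 -> C) x = 0) ->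
  q1 x = 0 /\ q2 x = 0.
Proof.
move=> D; split.
- rewrite -(D (del R (inord 2))); apply/esym/derive_line => h.
  by have [e0 e1 e2] := q_del2 h x; rewrite /g2 e1 e2 mulrDr mulrC.
- rewrite -(D (del R (inord 1))); apply/esym/derive_line => h.
  by have [e0 e1 e2] := q_del1 h x; rewrite /g2 e1 e2 mulrDl.
Qed.

Lemma g1_vanishes_on_axes x :
  q0 x = 0 -> q1 x = 0 -> vanishes_on_axes (g1 chV) x.
Proof.
move=> x0 x1 i h; move: i; rewrite /g1.
apply: (del_cases (P := fun v => q0 (h *: v + x) * q1 (h *: v + x) = 0)).
- by have [-> -> _] := q_del0 h x; rewrite x1 mulr0.
- by have [-> -> _] := q_del1 h x; rewrite x0 mul0r.
- by have [-> -> _] := q_del2 h x; rewrite x0 mul0r.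
Qed.

Lemma g2_vanishes_on_axes c x :
  q1 x = 0 -> q2 x = 0 -> vanishes_on_axes (g2 c) x.
Proof.
move=> x1 x2 i h; move: i; rewrite /g2.
apply: (del_cases (P := fun v => q1 (h *: v + x) * q2 (h *: v + x) = 0)).
- by have [_ -> ->] := q_del0 h x; rewrite x1 mul0r.
- by have [_ -> ->] := q_del1 h x; rewrite x2 mulr0.
- by have [_ -> ->] := q_del2 h x; rewrite x1 mul0r.
Qed.

Lemma crossing_line_to_zero_section f g t :
  holomorphic f -> holomorphic g -> cancel f g -> cancel g f ->
  pushes_to f (e1 R) (e2 R) ->
  exists c s, f (incl chV (vec3 0 0 t)) = incl c (vec3 s 0 0).
Proof.
move=> fH gH fK gK fpi.
have [c [y fy]] := incl_cover (f (incl chV (vec3 0 0 t))).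
have [y1 y2] : q1 y = 0 /\ q2 y = 0.
  apply: (@g2_critical c) => v.
  apply: (crossing_critical (a := @g1 R) (b := @g2 R) _ _
    (@g2_holo R) (@g2_glue R) g2_0 fpi v fH gH fK gK fy) => //.
  by apply: g1_vanishes_on_axes; rewrite ?q0E ?q1E.
by exists c, (q0 y); rewrite fy [in LHS](vec3P y) y1 y2.
Qed.

Lemma zero_section_to_crossing_line f g c s :
  holomorphic f -> holomorphic g -> cancel f g -> cancel g f ->
  pushes_to g (e2 R) (e1 R) ->
  exists t, g (incl c (vec3 s 0 0)) = incl chV (vec3 0 0 t).
Proof.
move=> fH gH fK gK gpi.
have [d [y gy]] := incl_cover (g (incl c (vec3 s 0 0))).
have [dV y0 y1] : [/\ d = chV, q0 y = 0 & q1 y = 0].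
  apply: g1_critical => v.
  apply: (crossing_critical (a := @g2 R) (b := @g1 R) _ _
    (@g1_holo R) (@g1_glue R) g1_0 gpi v gH fH gK fK gy) => //.
  by apply: g2_vanishes_on_axes; rewrite ?q1E ?q2E.
by exists (q2 y); rewrite gy dV [in LHS](vec3P y) y0 y1.
Qed.

(** * Compactness of the zero section *)

Lemma zero_section_unit_discs c s : exists d s', `|s'| <= 1 /\
  incl c (vec3 s 0 0) = incl d (vec3 s' 0 0) :> W3.
Proof.
case: (real_leP (normr_real s) (@real1 C)) => s1; first by exists c, s.
have s0 : s != 0 by rewrite -normr_gt0; exact: lt_trans ltr01 s1.
exists (~~ c), s^-1; split.
  by rewrite normfV invf_le1 ?normr_gt0// ltW.
apply/incl_eqP; right; rewrite q0E; split=> //; first by case: (c).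
by rewrite /trans q0E q1E q2E !mulr0.
Qed.

Lemma continuous_on_zero_section g c : holomorphic g ->
  (forall s, range (incl chV) (g (incl c (vec3 s 0 0)))) ->
  continuous (fun s : C => q2 (local_rep g c chV (vec3 s 0 0))).
Proof.
move=> gH gr s.
have vc : {for s, continuous (fun s : C => vec3 s 0 0)}.
  rewrite (_ : (fun s => _) = (fun s : C => s *: del R (inord 0))).
    exact: scalel_continuous.
  by apply/funext => u; rewrite vec3_del !scale0r !addr0.
apply: (@continuous_comp _ _ _ (fun s : C => vec3 s 0 0)
  (fun x => q2 (local_rep g c chV x))) => //.
apply: continuous_comp.
  exact/differentiable_continuous/gH.2/gr.
exact/differentiable_continuous/differentiable_q2.
Qed.

End W3.

Theorem lemma5p7 (R : realType) : ~ poisson_isomorphic (e1 R) (e2 R).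
Proof.
move=> [f [[fH [g [gH fK gK]]] fpi]].
have gpi := pushes_to_inv fH gH fK gK fpi.
have gline c s := zero_section_to_crossing_line c s fH gH fK gK gpi.
have gbounded c : exists M : R, forall s, `|s| <= 1 ->
    `|q2 (local_rep g c chV (vec3 s 0 0))| <= M%:C%C.
  apply: bounded_on_unit_disc; apply: continuous_on_zero_section => // s.
  by have [t ->] := gline c s; exists (vec3 0 0 t).
have [M0 HM0] := gbounded chU; have [M1 HM1] := gbounded chV.
pose M := Num.max M0 M1.
have HM c s : `|s| <= 1 -> `|q2 (local_rep g c chV (vec3 s 0 0))| <= M%:C%C.
  move=> s1.
  case: c; [apply: le_trans (HM1 _ s1) _|apply: le_trans (HM0 _ s1) _];
    by rewrite lecR le_max lexx ?orbT.
(* The point of the crossing line whose coordinate v2 exceeds the bound. *)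
pose t : CC R := (`|M| + 1)%:C%C.
have [c [s fs]] := crossing_line_to_zero_section t fH gH fK gK fpi.
have [d [s' [s'1 ss']]] := zero_section_unit_discs c s.
have gs' : g (incl d (vec3 s' 0 0)) = incl chV (vec3 0 0 t).
  by rewrite -ss' -fs fK.
have := HM d s' s'1; rewrite (local_repE gs') q2E /t norm_real_complex lecR.
rewrite ger0_norm ?addr_ge0//; apply/negP; rewrite -ltNge.
by apply: le_lt_trans (ler_norm M) _; rewrite ltrDl.
Qed.
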